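(* Let $0<R_\oplus<R_{\mathrm{LEO}}<R_{\mathrm{GEO}}$. Let $N_{\mathrm{LEO}}\ge1$ LEO satellites be i.i.d. uniform on the sphere of radius $R_{\mathrm{LEO}}$, let the IoT device be at $(R_\oplus,0,0)$ and the GEO satellite at $(R_{\mathrm{GEO}},\Theta,0)$ with $\Theta\in(0,\pi)$. The relay is the LEO satellite nearest to the IoT device; let $\theta_{\mathrm{IL}}$ be its central angle to the IoT device and $l_{\mathrm{LG}}$ its distance to the GEO satellite. Let $l_{\mathrm{IL}}^{\max}\in[R_{\mathrm{LEO}}-R_\oplus,\sqrt{R_{\mathrm{LEO}}^2-R_\oplus^2}]$, $l_{\mathrm{LG}}^{\max}>0$, and $\theta_{\mathrm{IL}}^{\max}=\arccos\left(\frac{R_{\mathrm{LEO}}^2+R_\oplus^2-(l_{\mathrm{IL}}^{\max})^2}{2R_{\mathrm{LEO}}R_\oplus}\right)$. Then the satellite availability probability $P^A=\mathbb P[\theta_{\mathrm{IL}}\le\theta_{\mathrm{IL}}^{\max},\ l_{\mathrm{LG}}\le l_{\mathrm{LG}}^{\max}]$ equals $$P^A=\int_0^{\theta_{\mathrm{IL}}^{\max}} f_{\theta_{\mathrm{IL}}}(\theta)\,P_{\mathrm{LG}}^A(\theta)\,d\theta,\qquad f_{\theta_{\mathrm{IL}}}(\theta)=\frac{N_{\mathrm{LEO}}\sin\theta}{2}\left(\frac{1+\cos\theta}{2}\right)^{N_{\mathrm{LEO}}-1},$$ where $P_{\mathrm{LG}}^A(\theta)=\mathbb P[l_{\mathrm{LG}}\le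 l_{\mathrm{LG}}^{\max}\mid\theta_{\mathrm{IL}}=\theta]$ is given, for $\theta\in(0,\pi)$, with $d_1(\theta)=\sqrt{R_{\mathrm{LEO}}^2+R_{\mathrm{GEO}}^2-2R_{\mathrm{LEO}}R_{\mathrm{GEO}}\cos(\theta-\Theta)}$ and $d_2(\theta)=\sqrt{R_{\mathrm{LEO}}^2+R_{\mathrm{GEO}}^2-2R_{\mathrm{LEO}}R_{\mathrm{GEO}}\cos(\theta+\Theta)}$, by $$P_{\mathrm{LG}}^A(\theta)=\begin{cases}0,& d_1(\theta)>l_{\mathrm{LG}}^{\max},\\ 1,& d_2(\theta)<l_{\mathrm{LG}}^{\max},\\ \frac1\pi\arccos\left(\frac{R_{\mathrm{LEO}}^2+R_{\mathrm{GEO}}^2-(l_{\mathrm{LG}}^{\max})^2}{2R_{\mathrm{LEO}}R_{\mathrm{GEO}}\sin\theta\sin\Theta}-\frac{\cos\theta\cos\Theta}{\sin\theta\sin\Theta}\right),&\text{otherwise.}\end{cases}$$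
   Context: Spherical coordinates $(r,\theta,\varphi)$ with origin at the Earth's center, $\theta$ polar angle, $\varphi$ azimuth. The central angle between two points is the angle at the origin between the rays to them. The relay (nearest LEO satellite) is the one with the smallest central angle to the IoT device; conditionally on its polar angle $\theta$, its azimuth is uniform. The distance between $(R_1,\theta_1,\varphi_1)$ and $(R_2,\theta_2,\varphi_2)$ is $\sqrt{R_1^2+R_2^2-2R_1R_2(\sin\theta_1\sin\theta_2\cos(\varphi_1-\varphi_2)+\cos\theta_1\cos\theta_2)}$. *)

(* Defs.v *)
From HB Require Import structures.
From mathcomp Require Import all_boot all_order all_algebra.
From mathcomp Require Import all_classical all_reals all_analysis.
Set Implicit Arguments. Unset Strict Implicit. Unset Printing Implicit Defensive.
Import Order.TTheory GRing.Theory Num.Theory.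
Import numFieldNormedType.Exports.
Local Open Scope classical_set_scope.
Local Open Scope ring_scope.

Section Defs.
Variable R : realType.

(* A point on a sphere of given radius, in spherical coordinates (theta, phi):
   theta = polar angle, phi = azimuth. *)
Definition sph := (R * R)%type.

Definition dist3 (R1 t1 p1 R2 t2 p2 : R) : R :=
  Num.sqrt (R1 ^+ 2 + R2 ^+ 2
            - 2 * R1 * R2 * (sin t1 * sin t2 * cos (p1 - p2) + cos t1 * cos t2)).

Definition central_angle (t1 p1 t2 p2 : R) : R :=
  acos (sin t1 * sin t2 * cos (p1 - p2) + cos t1 * cos t2).

Definition angle_to_IoT (x : sph) : R := central_angle x.1 x.2 0 0.

(* The relay: the first satellite of (x0 :: s) with smallest central angle
   to the IoT device (ties have probability zero). *)
Definition relay (x0 : sph) (s : seq sph) : sph :=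
  foldl (fun best x => if angle_to_IoT x < angle_to_IoT best then x else best) x0 s.

(* Uniform (normalized surface) probability on the sphere, in spherical
   coordinates: density sin(theta)/(4 pi) on [0,pi] x [0,2pi]. *)
Definition unif_sphere_int (g : R -> R -> \bar R) : \bar R :=
  (\int[@lebesgue_measure R]_(t in `[0%R, (pi : R)]%classic)
     \int[@lebesgue_measure R]_(p in `[0%R, (2 * pi : R)%R]%classic)
        (g t p * (sin t / (4 * pi))%:E))%E.

(* Probability of an event E about n i.i.d. uniform points on the sphere
   (iterated integral of the indicator of E w.r.t. the n-fold product). *)
Fixpoint iid_prob (n : nat) (E : set (seq sph)) : \bar R :=
  match n with
  | 0%N => (\1_E [::] : R)%:E
  | n'.+1 => unif_sphere_int (fun t p => iid_prob n' (fun s => E ((t, p) :: s)))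
  end.

Definition avail_event (RL RG Th thmax lGmax : R) : set (seq sph) :=
  fun s => match s with
           | [::] => False
           | x :: s' => let r := relay x s' in
                        angle_to_IoT r <= thmax /\ dist3 RL r.1 r.2 RG Th 0 <= lGmax
           end.

Definition theta_IL_max (RE RL lILmax : R) : R :=
  acos ((RL ^+ 2 + RE ^+ 2 - lILmax ^+ 2) / (2 * RL * RE)).

Definition f_theta_IL (N : nat) (t : R) : R :=
  N%:R * sin t / 2 * ((1 + cos t) / 2) ^+ N.-1.

Definition d1 (RL RG Th t : R) : R :=
  Num.sqrt (RL ^+ 2 + RG ^+ 2 - 2 * RL * RG * cos (t - Th)).
Definition d2 (RL RG Th t : R) : R :=
  Num.sqrt (RL ^+ 2 + RG ^+ 2 - 2 * RL * RG * cos (t + Th)).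

Definition P_LG_A (RL RG Th lGmax t : R) : R :=
  if d1 RL RG Th t > lGmax then 0
  else if d2 RL RG Th t < lGmax then 1
  else pi^-1 * acos ((RL ^+ 2 + RG ^+ 2 - lGmax ^+ 2) / (2 * RL * RG * sin t * sin Th)
                     - cos t * cos Th / (sin t * sin Th)).

End Defs.

(* Main.v *)
Require Import Defs.
From HB Require Import structures.
From mathcomp Require Import all_boot all_order all_algebra.
From mathcomp Require Import all_classical all_reals all_analysis.
From mathcomp Require Import measurable_realfun ring lra.
Import Order.TTheory GRing.Theory Num.Theory.
Import numFieldNormedType.Exports.
Local Open Scope classical_set_scope.
Local Open Scope ring_scope.

(** Add the satellites one at a time, keeping the current best one. If its polar
    angle is [t0], the next satellite replaces it exactly when its
    polar angle is below [t0]; otherwise, with probability [cap t0 = (1 + cos t0) / 2], nothing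
    changes. By induction, the probability that the relay among [n] further
    satellites is admissible is
      [cap t0 ^ n * 1_A(t0, p0) + int_0^t0 f_n(u) azim A u du],
    where [azim A u] averages the indicator of [A] over the azimuth; the inductive
    step is Tonelli on the triangle [0 <= u <= t <= t0], using [cap' = - sin / 2].
    Starting from a dummy satellite at the south pole ([t0 = pi], [cap pi = 0])
    gives the theorem. *)

Section Geometry.
Context {R : realType}.
Local Notation mu := (@lebesgue_measure R).
Implicit Types (t u : R) (k f : R -> \bar R).

(** * Polar distribution of a uniform point on the sphere *)

(* Fraction of the sphere with polar angle at least [t]. *)
Definition cap t : R := (1 + cos t) / 2.

(** Moves the domain into the integrand, so that a bound depending on an outer variable can pass
    through Tonelli on the whole plane. *)
Lemma integral_itv_if (i : interval R) f :
  (\int[mu]_(x in [set` i]) f x = \int[mu]_x (if x \in i then f x else 0))%E.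
Proof.
rewrite integral_mkcond; apply: eq_integral => x _.
by rewrite patchE mem_setE.
Qed.

Lemma measurable_sin : measurable_fun setT (@sin R).
Proof. exact: (continuous_measurable_fun (@continuous_sin R)). Qed.

Lemma measurable_cos : measurable_fun setT (@cos R).
Proof. exact: (continuous_measurable_fun (@continuous_cos R)). Qed.

Lemma measurable_cap : measurable_fun setT cap.
Proof.
by apply: measurable_funM => //; apply: measurable_funD => //;
  exact: measurable_cos.
Qed.

Lemma measurable_halfsin : measurable_fun setT (fun t => sin t / 2 : R).
Proof. by apply: measurable_funM => //; exact: measurable_sin. Qed.

Lemma halfsin_ge0 t : 0 <= t <= pi -> 0 <= sin t / 2.
Proof. by move=> t0pi; rewrite divr_ge0// sin_ge0_pi. Qed.

Lemma cap_ge0 t : 0 <= cap t.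
Proof. by rewrite divr_ge0// -[1]opprK addrC subr_ge0 cos_geN1. Qed.

(** [- cap] is an antiderivative of [sin t / 2], the density of the polar angle of a uniform
    point. *)
Lemma integral_halfsin a b : a <= b ->
  (\int[mu]_(t in `[a, b]) (sin t / 2)%:E = (cap a - cap b)%:E)%E.
Proof.
rewrite le_eqVlt => /predU1P[->|ab].
  by rewrite set_itv1 integral_set1 subrr.
have dF (x : R) : is_derive x 1 (fun t : R => - cap t) (sin x / 2).
  rewrite /cap; apply: is_derive_eq.
  by rewrite /GRing.scale /=; ring.
have cF : continuous (fun t : R => - cap t).
  move=> x; apply: differentiable_continuous.
  by apply/derivable1_diffP; case: (dF x).
have cs : continuous (fun t : R => sin t / 2).
  move=> x; apply: cvgM; [exact: continuous_sin|exact: cvg_cst].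
rewrite (@continuous_FTC2 _ _ (fun t => - cap t))//.
- by rewrite -EFinB opprK addrC.
- exact: continuous_subspaceT.
- split.
  + by move=> x _; case: (dF x).
  + apply: cvg_at_right_filter; exact: cF.
  + apply: cvg_at_left_filter; exact: cF.
- by move=> x _; rewrite derive1E; apply: derive_val.
Qed.

(** * Tonelli on the triangle below the diagonal *)

Definition tri b (z : R * R) := (z.1 \in `[0, b]) && (z.2 \in `[0, z.1]).

Lemma triE b t u : tri b (t, u) = [&& 0 <= u, u <= t & t <= b].
Proof. by rewrite /tri !in_itv/=; apply/idP/idP; lra. Qed.

Lemma measurable_tri b (g : R * R -> \bar R) : measurable_fun setT g ->
  measurable_fun setT (fun z => if tri b z then g z else 0%E).
Proof.
move=> mg; apply: measurable_fun_ifT => //.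
rewrite /tri; under eq_fun do rewrite !in_itv/=.
by apply: measurable_and; apply: measurable_and; apply: measurable_fun_ler.
Qed.

Lemma tri_ge0 b (g : R * R -> \bar R) :
  (forall z, tri b z -> 0 <= g z)%E ->
  forall z, (0 <= if tri b z then g z else 0)%E.
Proof. by move=> g0 z; case: ifPn => // /g0. Qed.

(** After exchanging the order, [t] runs over [[u, b]] for fixed [u], and the inner integral of
    [sin t / 2] is [cap u - cap b]. *)
Lemma integral_tri b (k : R -> \bar R) : measurable_fun setT k ->
  (forall u : R, (0 <= u <= b)%R -> (0 <= k u)%E) -> b <= pi ->
  (\int[mu]_(t in `[0%R, b]) ((sin t / 2)%:E * \int[mu]_(u in `[0%R, t]) k u)
   = \int[mu]_(u in `[0%R, b]) (k u * (cap u - cap b)%:E))%E.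
Proof.
move=> mk k0 bpi.
pose g (z : R * R) := ((sin z.1 / 2)%:E * k z.2)%E.
have mg : measurable_fun setT g.
  apply: emeasurable_funM; last exact: (measurableT_comp mk).
  by apply/measurable_EFinP; exact: (measurableT_comp measurable_halfsin).
have g0 z : tri b z -> (0 <= g z)%E.
  case: z => t u; rewrite triE => /and3P[u0 ut tb].
  by rewrite mule_ge0// ?lee_fin ?halfsin_ge0 ?k0//=; lra.
rewrite !integral_itv_if.
transitivity (\int[mu]_x \int[mu]_y if tri b (x, y) then g (x, y) else 0)%E.
  apply: eq_integral => t _; rewrite /tri /g /=; case: ifPn => /= [tb|_]; last first.
    by rewrite integral0.
  move: tb; rewrite in_itv/= => tb.
  rewrite -(@ge0_integralZl _ _ _ mu `[0%R, t]%classic (measurable_itv _) k).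
  - by rewrite integral_itv_if.
  - exact: measurable_funTS.
  - by move=> u /=; rewrite !in_itv/= => ?; apply: k0; lra.
  - by rewrite lee_fin halfsin_ge0//; lra.
rewrite (fubini_tonelli (m1 := mu) (m2 := mu) _ (measurable_tri b _ mg) (tri_ge0 _ _ g0)).
apply: eq_integral => u _; case: ifPn => /= uu.
- move: (uu); rewrite in_itv/= => /andP[u0 ut].
  rewrite -integral_halfsin// muleC -(@ge0_integralZr _ _ _ mu _ _ (fun t => (sin t / 2)%:E))//; last 3 first.
  + by apply: measurable_funTS; apply/measurable_EFinP; exact: measurable_halfsin.
  + by move=> t /=; rewrite in_itv/= lee_fin => ?; rewrite halfsin_ge0//; lra.
  + by apply: k0; rewrite u0.
  by rewrite integral_itv_if; apply: eq_integral => t _; rewrite triE in_itv/= u0.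
- apply: integral0_eq => t _; rewrite triE.
  by case: ifPn => // ?; exfalso; move: uu; rewrite in_itv/=; lra.
Qed.

Lemma measurable_integral_itv b (k : R -> \bar R) : measurable_fun setT k ->
  (forall u : R, (0 <= u <= b)%R -> (0 <= k u)%E) ->
  measurable_fun `[0, b] (fun t => \int[mu]_(u in `[0%R, t]) k u)%E.
Proof.
move=> mk k0.
have mg : measurable_fun setT (fun z : R * R => k z.2).
  exact: (measurableT_comp mk).
have g0 (z : R * R) : tri b z -> (0 <= k z.2)%E.
  by case: z => t u; rewrite triE => ?; apply: k0 => /=; lra.
have := measurable_fun_fubini_tonelli_F (m2 := mu) _ (measurable_tri b _ mg) (tri_ge0 _ _ g0).
move/(@measurable_funTS _ _ _ _ `[0, b]%classic).
apply: eq_measurable_fun => t; rewrite mem_setE => tb.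
by rewrite /fubini_F integral_itv_if /tri/= tb.
Qed.

(** * Averaging over the azimuth *)

Definition azim (A : set (R * R)) t : \bar R :=
  (((2 * pi)^-1)%:E * mu (`[0%R, (2 * pi)%R] `&` [set p | A (t, p)]))%E.

Lemma azim_ge0 A t : (0 <= azim A t)%E.
Proof. by rewrite mule_ge0// lee_fin invr_ge0 mulr_ge0// pi_ge0. Qed.

Lemma measurable_azim A : measurable A -> measurable_fun setT (azim A).
Proof.
move=> mA; apply: emeasurable_funM => //.
have mAA : measurable (A `&` (setT `*` `[0, 2 * pi]%classic)).
  by apply: measurableI => //; exact: measurableX.
apply: eq_measurable_fun (measurable_fun_xsection mu mAA) => t _ /=.
congr (mu _); apply/seteqP; split => p.
  by rewrite /xsection/= in_setE => -[? [_ ?]].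
by rewrite /xsection/= in_setE => -[].
Qed.

Lemma measurable_azimuths (A : set (R * R)) t : measurable A ->
  measurable [set p | A (t, p)].
Proof.
move=> /(measurable_xsection t); congr measurable.
by apply/seteqP; split => p; rewrite /xsection/= in_setE.
Qed.

(** Form of one induction step: [c] is the probability that a new best satellite is never replaced,
    [d] the contribution of later replacements, which does not depend on its azimuth. The azimuth
    range [2 * pi] turns [sin t / (4 * pi)] into [sin t / 2]. *)
Lemma integral_azim A t (c : R) (d : \bar R) : measurable A ->
  0 <= c -> (0 <= d)%E -> 0 <= sin t ->
  (\int[mu]_(p in `[0%R, (2 * pi)%R])
     (((c * \1_A (t, p))%:E + d) * (sin t / (4 * pi))%:E)
   = (sin t / 2)%:E * (c%:E * azim A t + d))%E.
Proof.
move=> mA c0 d0 s0.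
have pi0 : 0 < pi :> R by exact: pi_gt0.
have sp0 : 0 <= sin t / (4 * pi) by rewrite divr_ge0// mulr_ge0// ltW.
have mAt := measurable_azimuths A t mA.
have indE p : \1_A (t, p) = \1_[set p | A (t, p)] p :> R.
  by rewrite !indicE; congr (_%:R); apply/idP/idP; rewrite !inE.
have mind : measurable_fun setT (fun p => c * \1_A (t, p)).
  under eq_fun do rewrite indE.
  by apply: measurable_funM => //; exact: measurable_indic.
rewrite ge0_integralZr//; last 2 first.
- apply: emeasurable_funD => //; apply: measurable_funTS.
  exact/measurable_EFinP.
- by move=> p _; rewrite adde_ge0// lee_fin mulr_ge0.
rewrite ge0_integralD//; last 2 first.
- by move=> p _; rewrite lee_fin mulr_ge0.
- by apply: measurable_funTS; exact/measurable_EFinP.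
have -> : (\int[mu]_(p in `[0%R, (2 * pi)%R]) (c * \1_A (t, p))%:E =
    c%:E * mu (`[0%R, (2 * pi)%R] `&` [set p | A (t, p)]))%E.
  under eq_integral do rewrite indE EFinM.
  rewrite ge0_integralZl//.
  - by rewrite integral_indic// setIC.
  - by apply: measurable_funTS; apply/measurable_EFinP; exact: measurable_indic.
rewrite integral_cst//= lebesgue_measure_itv/= lte_fin mulr_gt0//= sube0.
rewrite ge0_muleDl//; last 2 first.
- by rewrite mule_ge0.
- by rewrite mule_ge0// lee_fin mulr_ge0// ltW.
rewrite ge0_muleDr//; last by rewrite mule_ge0// azim_ge0.
congr (_ + _)%E.
- rewrite /azim !muleA -!EFinM muleAC -EFinM; congr (_%:E * _)%E.
  by move: pi0; move: pi => q q0; field; rewrite gt_eqF.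
- rewrite -muleA -EFinM muleC; congr (_%:E * _)%E.
  by move: pi0; move: pi => q q0; field; rewrite gt_eqF.
Qed.

Lemma azim_fin A t : measurable A -> azim A t \is a fin_num.
Proof.
move=> mA; rewrite fin_numM// ge0_fin_numE//.
have mAt := measurable_azimuths A t mA.
apply: le_lt_trans (_ : mu `[0%R, (2 * pi)%R] < +oo)%E.
  by apply: le_measure; rewrite ?inE//; exact: measurableI.
by rewrite lebesgue_measure_itv/=; case: ifP; rewrite ?ltry.
Qed.

(** * Law of the relay by induction on the number of satellites *)

Lemma f_theta_IL_ge0 n t : 0 <= t <= pi -> 0 <= f_theta_IL n t.
Proof.
move=> t0pi; rewrite /f_theta_IL mulr_ge0 ?exprn_ge0 ?cap_ge0//.
by rewrite -mulrA mulr_ge0// halfsin_ge0.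
Qed.

Lemma measurable_f_theta_IL n : measurable_fun setT (@f_theta_IL R n).
Proof.
apply: measurable_funM; last by apply: measurable_funX; exact: measurable_cap.
by apply: measurable_funM => //; apply: measurable_funM => //; exact: measurable_sin.
Qed.

(** Probability that the nearest of [n] satellites has polar angle at most [b] and lies in [A]; it
    is 0 for [n = 0], since [f_theta_IL 0] vanishes. *)
Definition relay_avail (A : set (R * R)) n b : \bar R :=
  (\int[mu]_(u in `[0%R, b]) ((f_theta_IL n u)%:E * azim A u))%E.

Section Relay.
Variable A : set (R * R).
Hypothesis mA : measurable A.

Let k n u := ((f_theta_IL n u)%:E * azim A u)%E.

Let mk n : measurable_fun setT (k n).
Proof.
apply: emeasurable_funM; last exact: measurable_azim.
by apply/measurable_EFinP; exact: measurable_f_theta_IL.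
Qed.

Let k_ge0 n u : 0 <= u <= pi -> (0 <= k n u)%E.
Proof. by move=> u0; rewrite mule_ge0 ?azim_ge0// lee_fin f_theta_IL_ge0. Qed.

Lemma relay_avail_ge0 n b : b <= pi -> (0 <= relay_avail A n b)%E.
Proof.
move=> bpi; apply: integral_ge0 => u /=; rewrite in_itv/= => ?.
by apply: k_ge0; lra.
Qed.

(** Conditioning on the first of [n.+1] satellites: at angle [t <= b] it becomes the current best,
    and with probability [cap b] it is farther than [b] and can be ignored. *)
Lemma relay_availS n b : 0 <= b <= pi ->
  (\int[mu]_(t in `[0%R, b])
      ((sin t / 2)%:E * ((cap t ^+ n)%:E * azim A t + relay_avail A n t))
   + (cap b)%:E * relay_avail A n b = relay_avail A n.+1 b)%E.
Proof.
move=> /andP[b0 bpi].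
have kb u : 0 <= u <= b -> (0 <= k n u)%E by move=> ?; apply: k_ge0; lra.
have kb' u : `[0, b]%classic u -> (0 <= k n u)%E.
  by rewrite /= in_itv/=; exact: kb.
pose h t := ((sin t / 2)%:E * ((cap t ^+ n)%:E * azim A t))%E.
have mh : measurable_fun setT h.
  apply: emeasurable_funM.
    by apply/measurable_EFinP; exact: measurable_halfsin.
  apply: emeasurable_funM; last exact: measurable_azim.
  by apply/measurable_EFinP; apply: measurable_funX; exact: measurable_cap.
have h0 t : `[0, b]%classic t -> (0 <= h t)%E.
  rewrite /= in_itv/= => ?; rewrite mule_ge0// ?lee_fin ?halfsin_ge0//; first lra.
  by rewrite mule_ge0 ?azim_ge0// lee_fin exprn_ge0// cap_ge0.
transitivity (\int[mu]_(t in `[0%R, b]) (h t +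
    (sin t / 2)%:E * relay_avail A n t) + (cap b)%:E * relay_avail A n b)%E.
  congr (_ + _)%E; apply: eq_integral => t; rewrite mem_setE in_itv/= => tb.
  rewrite ge0_muleDr//.
    by rewrite mule_ge0 ?azim_ge0// lee_fin exprn_ge0// cap_ge0.
  by apply: relay_avail_ge0; lra.
rewrite ge0_integralD//; last 3 first.
- exact: measurable_funTS.
- move=> t /=; rewrite in_itv/= => ?.
  by rewrite mule_ge0// ?lee_fin ?halfsin_ge0 ?relay_avail_ge0//; lra.
- apply: emeasurable_funM; last exact: (measurable_integral_itv _ _ (mk n) kb).
  by apply: measurable_funTS; apply/measurable_EFinP; exact: measurable_halfsin.
rewrite (integral_tri _ _ (mk n) kb bpi) -ge0_integralZl//; last 2 first.
- by apply: measurable_funTS; exact: (mk n).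
- by rewrite lee_fin cap_ge0.
(* [cap] decreases on [[0, pi]], so all three integrands are nonnegative and their integrals can be
   merged. *)
have capb u : 0 <= u <= b -> cap b <= cap u.
  move=> ?; rewrite ler_pM2r// lerD2l.
  by rewrite leNgt ltr_cos ?in_itv/= -?leNgt; lra.
have mkc : measurable_fun setT (fun u => k n u * (cap u - cap b)%:E)%E.
  apply: emeasurable_funM; first exact: (mk n).
  by apply/measurable_EFinP; apply: measurable_funB => //; exact: measurable_cap.
have mkb : measurable_fun setT (fun u => (cap b)%:E * k n u)%E.
  by apply: emeasurable_funM => //; exact: (mk n).
have kc0 u : `[0, b]%classic u -> (0 <= k n u * (cap u - cap b)%:E)%E.
  by rewrite /= in_itv/= => ?; rewrite mule_ge0 ?kb// lee_fin subr_ge0 capb.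
have kb0 u : `[0, b]%classic u -> (0 <= (cap b)%:E * k n u)%E.
  by move=> ?; rewrite mule_ge0 ?kb'// lee_fin cap_ge0.
have mD f : measurable_fun setT f -> measurable_fun `[0, b] f.
  exact: measurable_funTS.
rewrite -addeA -(ge0_integralD mu _ kc0 (mD _ mkc) kb0 (mD _ mkb))//.
rewrite -(ge0_integralD mu _ h0 (mD _ mh))//; last 2 first.
- by move=> u uu; rewrite adde_ge0 ?kc0 ?kb0.
- by apply: mD; exact: emeasurable_funD.
apply: eq_integral => u _; rewrite /h /k.
(* Finiteness of [azim] brings the identity down to reals. The [cap b] terms cancel, leaving
   [f_(n+1) = sin / 2 * cap ^ n + cap * f_n]. *)
rewrite -(fineK (azim_fin A u mA)) -!EFinM -!EFinD; congr EFin.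
rewrite /f_theta_IL -!/(cap _) -pred_Sn; move: (fine _) => a; clear.
(* For [n = 0] the truncated exponent [n.-1] is harmless, because the factor [n%:R] is zero. *)
case: n => [|m] /=; rewrite ?expr0 ?exprS -?natr1; ring.
Qed.

Lemma angle_to_IoTE t p : 0 <= t <= pi -> angle_to_IoT (t, p) = t.
Proof.
move=> tpi; rewrite /angle_to_IoT /central_angle/= sin0 cos0 mulr0 mul0r add0r mulr1.
by rewrite cosK// in_itv.
Qed.

Lemma cap_pi : cap pi = 0.
Proof. by rewrite /cap cospi subrr mul0r. Qed.

Lemma measurable_relay_avail n :
  measurable_fun `[0, pi] (relay_avail A n).
Proof. exact: (measurable_integral_itv _ _ (mk n) (@k_ge0 n)). Qed.

(* [B] is the event stated through [angle_to_IoT], whose measurability off the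
   strip [0 <= t <= pi] is unclear; [A] is a measurable set agreeing with it there. *)
Lemma iid_prob_relay (B : set (R * R)) n t0 p0 :
  (forall t p, 0 <= t <= pi -> B (t, p) <-> A (t, p)) -> 0 <= t0 <= pi ->
  iid_prob n (fun s => B (relay (t0, p0) s)) =
  ((cap t0 ^+ n * \1_A (t0, p0))%:E + relay_avail A n t0)%E.
Proof.
move=> BA; elim: n t0 p0 => [|n IH] t0 p0 t0pi.
  rewrite expr0 mul1r [X in (_ + X)%E](_ : _ = 0%E) ?adde0.
    rewrite /= !indicE; congr EFin; congr ((nat_of_bool _)%:R); apply/idP/idP; rewrite !inE => ?; exact/BA.
  apply: integral0_eq => t _; rewrite /f_theta_IL.
  by rewrite !mul0r mul0e.
(* [G t] is the contribution of a next satellite at angle [t] that takes over as best; [C] is the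
   success probability when the old best is kept. *)
pose G t := ((sin t / 2)%:E * ((cap t ^+ n)%:E * azim A t + relay_avail A n t))%E.
pose C := ((cap t0 ^+ n * \1_A (t0, p0))%:E + relay_avail A n t0)%E.
have C0 : (0 <= C)%E.
  rewrite adde_ge0// ?relay_avail_ge0//; last lra.
  by rewrite lee_fin mulr_ge0// exprn_ge0// cap_ge0.
have G0 t : 0 <= t <= pi -> (0 <= G t)%E.
  move=> tpi; rewrite mule_ge0 ?lee_fin ?halfsin_ge0// adde_ge0//.
    by rewrite mule_ge0 ?azim_ge0// lee_fin exprn_ge0// cap_ge0.
  by rewrite relay_avail_ge0//; lra.
have mhs : measurable_fun setT (fun t => (sin t / 2)%:E : \bar R).
  by apply/measurable_EFinP; exact: measurable_halfsin.
have mG : measurable_fun `[0, pi] G.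
  apply: emeasurable_funM; first exact: measurable_funTS.
  apply: emeasurable_funD; last exact: measurable_relay_avail.
  apply: measurable_funTS; apply: emeasurable_funM; last exact: measurable_azim.
  by apply/measurable_EFinP; apply: measurable_funX; exact: measurable_cap.
have hs0 t : 0 <= t <= pi -> (0 <= (sin t / 2)%:E)%E.
  by move=> ?; rewrite lee_fin halfsin_ge0.
transitivity (\int[mu]_(t in `[0%R, (pi : R)])
    if (t < t0)%R then G t else (sin t / 2)%:E * C)%E.
  rewrite /= /unif_sphere_int; apply: eq_integral => t; rewrite mem_setE in_itv/= => tpi.
  transitivity (\int[mu]_(p in `[0%R, (2 * pi)%R])
    ((if (t < t0)%R then
      (cap t ^+ n * \1_A (t, p))%:E + relay_avail A n t else C) * (sin t / (4 * pi))%:E))%E.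
    apply: eq_integral => p _; rewrite !angle_to_IoTE//.
    by case: ifPn => _; rewrite IH.
  case: ifPn => _.
    rewrite integral_azim//.
    - by rewrite exprn_ge0// cap_ge0.
    - by rewrite relay_avail_ge0//; lra.
    - exact: sin_ge0_pi.
  have pi0 : 0 < pi :> R by exact: pi_gt0.
  rewrite integral_cst//= lebesgue_measure_itv/= lte_fin mulr_gt0//= sube0.
  rewrite -muleA -EFinM muleC; congr (_%:E * _)%E.
  by move: pi0; move: pi => q q0; field; rewrite gt_eqF.
have split_pi : `[0, pi]%classic = `[0, t0[ `|` `[t0, pi] :> set R.
  by rewrite -itv_bndbnd_setU// bnd_simp; lra.
rewrite split_pi ge0_integral_setU//; last 3 first.
- rewrite -split_pi; apply: measurable_fun_if => //.
  + exact: measurable_fun_ltr.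
  + exact: measurable_funS mG.
  + apply: measurable_funTS; exact: emeasurable_funM.
- move=> t; rewrite -split_pi/= in_itv/= => tpi.
  by case: ifPn => _; [exact: G0|rewrite mule_ge0// hs0].
- by apply/disj_setPLR => t/=; rewrite !in_itv/=; lra.
rewrite -relay_availS//.
have -> : (\int[mu]_(x in `[0%R, t0[) (if (x < t0)%R then G x else (sin x / 2)%:E * C)
   = \int[mu]_(x in `[0%R, t0]) G x)%E.
  rewrite -integral_itv_bndo_bndc.
    by apply: eq_integral => t; rewrite mem_setE in_itv/= => /andP[_ ->].
  by apply: measurable_funS mG => // t /=; rewrite !in_itv/=; lra.
(* Beyond [t0] the value [C] is constant and the polar density has total mass
   [cap t0 - cap pi = cap t0]. *)
have -> : (\int[mu]_(x in `[t0, pi]) (if (x < t0)%R then G x else (sin x / 2)%:E * C)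
   = (cap t0)%:E * C)%E.
  under eq_integral => t.
    rewrite mem_setE in_itv/= => /andP[tt _]; rewrite ltNge tt/=; over.
  rewrite ge0_integralZr//.
  - by rewrite integral_halfsin ?cap_pi ?subr0//; lra.
  - exact: measurable_funTS.
  - by move=> t/=; rewrite in_itv/= => ?; apply: hs0; lra.
rewrite ge0_muleDr//; last 2 first.
- by rewrite lee_fin mulr_ge0// exprn_ge0// cap_ge0.
- by rewrite relay_avail_ge0//; lra.
by rewrite -EFinM mulrA -exprS addeCA.
Qed.
End Relay.

(** * Closed form of the GEO link probability *)

Lemma cos_superlevel c : -1 <= c <= 1 ->
  mu (`[0%R, (2 * pi)%R] `&` [set p | c <= cos p]) = (2 * acos c)%:E.
Proof.
move=> c11; set a := acos c.
have cosa : cos a = c by rewrite acosK// in_itv.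
have a0 : 0 <= a by exact: acos_ge0.
have api : a <= pi by exact: acos_lepi.
have cosle q : 0 <= q <= pi -> (c <= cos q) = (q <= a).
  by move=> qpi; rewrite -cosa leNgt ltr_cos ?in_itv/= -?leNgt// a0.
(* On a full period the superlevel set is the complement of an open arc centred at [pi]. Beyond
   [pi], the reflection of [p] to [2 * pi - p] leads back to [[0, pi]], where [cos] decreases. *)
have -> : `[0, 2 * pi]%classic `&` [set p | c <= cos p] =
    `[0, 2 * pi]%classic `\` `]a, 2 * pi - a[ :> set R.
  apply/seteqP; split => p /=; rewrite !in_itv/= => -[p2pi cp]; split => //.
    have [ppi|ppi] := leP p pi.
      by move: cp; rewrite cosle; lra.
    move: cp; rewrite -cosN -(cosD2pi (- p)) cosle; lra.
  have [ppi|ppi] := leP p pi.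
    by rewrite cosle; lra.
  by rewrite -cosN -(cosD2pi (- p)) cosle; lra.
have mfin : (mu `[0%R, (2 * pi)%R]%classic < +oo)%E.
  by rewrite lebesgue_measure_itv/=; case: ifP; rewrite ?ltry.
have -> : mu (`[0%R, (2 * pi)%R]%classic `\` `]a, (2 * pi - a)%R[%classic) =
    (mu `[0%R, (2 * pi)%R]%classic -
     mu (`[0%R, (2 * pi)%R]%classic `&` `]a, (2 * pi - a)%R[%classic))%E.
  exact: measureD.
rewrite setIidr; last by move=> p /=; rewrite !in_itv/=; lra.
rewrite !lebesgue_measure_itv/= !lte_fin mulr_gt0 ?pi_gt0// sube0.
(* The removed arc is empty exactly when [a = pi], that is [c = -1]. *)
case: ifPn => ?; rewrite ?sube0 -?EFinB; congr EFin; lra.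
Qed.

(** A negative radicand is harmless: [Num.sqrt] sends it to 0, which is at most [l]. *)
Lemma dist3_le r1 t1 p1 r2 t2 p2 l : 0 <= l ->
  (dist3 r1 t1 p1 r2 t2 p2 <= l) =
  (r1 ^+ 2 + r2 ^+ 2 - 2 * r1 * r2 *
    (sin t1 * sin t2 * cos (p1 - p2) + cos t1 * cos t2) <= l ^+ 2).
Proof.
move=> l0; rewrite /dist3 -[X in _ <= X]ger0_norm// -sqrtr_sqr ler_sqrt//.
exact: sqr_ge0.
Qed.

Lemma sqrt_lt_sqr (x l : R) : 0 < l -> (Num.sqrt x < l) = (x < l ^+ 2).
Proof.
move=> l0; rewrite -[X in _ < X]gtr0_norm// -sqrtr_sqr ltr_sqrt//.
by rewrite exprn_gt0.
Qed.

(** The squared distance is affine and decreasing in [q = cos p], so being within [l] means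
    [c <= q], with [c] the argument of [acos]. Since [d1] and [d2] are the distances at [q = 1] and
    [q = -1], the three branches are [c > 1], [c < -1] and [c] in [[-1, 1]]. *)
Lemma P_LG_A_azim (RL RG Th l t : R) : 0 < RL -> 0 < RG -> 0 < l ->
  0 < Th < pi -> 0 < t < pi ->
  (P_LG_A RL RG Th l t)%:E =
  azim [set z | dist3 RL z.1 z.2 RG Th 0 <= l] t.
Proof.
move=> RL0 RG0 l0 /andP[Th0 Thpi] /andP[t0 tpi].
have st : 0 < sin t by apply: sin_gt0_pi; rewrite t0.
have sT : 0 < sin Th by apply: sin_gt0_pi; rewrite Th0.
rewrite /P_LG_A /d1 /d2 /azim /=.
set c := (X in acos X).
have K0 : 0 < 2 * RL * RG * sin t * sin Th by rewrite !mulr_gt0.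
have cK : c * (2 * RL * RG * sin t * sin Th) =
    RL ^+ 2 + RG ^+ 2 - l ^+ 2 - 2 * RL * RG * (cos t * cos Th).
  by rewrite /c; field; rewrite !gt_eqF.
have leE q : (RL ^+ 2 + RG ^+ 2 - 2 * RL * RG *
    (sin t * sin Th * q + cos t * cos Th) <= l ^+ 2) = (c <= q).
  rewrite -[RHS](ler_pM2r K0) cK; apply/idP/idP; lra.
have ltE q : (RL ^+ 2 + RG ^+ 2 - 2 * RL * RG *
    (sin t * sin Th * q + cos t * cos Th) < l ^+ 2) = (c < q).
  rewrite -[RHS](ltr_pM2r K0) cK; apply/idP/idP; lra.
have -> : [set p | dist3 RL t p RG Th 0 <= l] = [set p | c <= cos p].
  by apply/seteqP; split => p /=; rewrite (dist3_le _ _ _ _ _ _ _ (ltW l0)) subr0 leE.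
have -> : (l < Num.sqrt (RL ^+ 2 + RG ^+ 2 - 2 * RL * RG * cos (t - Th))) = (1 < c).
  rewrite ltNge -[X in _ <= X](gtr0_norm l0) -sqrtr_sqr ler_sqrt ?sqr_ge0//.
  rewrite cosB (_ : cos t * cos Th + _ = sin t * sin Th * 1 + cos t * cos Th).
    by rewrite leE -ltNge.
  by rewrite mulr1 addrC.
rewrite sqrt_lt_sqr// cosD (_ : cos t * cos Th - _ =
    sin t * sin Th * (-1) + cos t * cos Th); last ring.
rewrite ltE; case: ifPn => [c1|]; [|rewrite -leNgt => c1; case: ifPn => [cN1|]].
- rewrite (_ : _ `&` _ = set0) ?measure0 ?mule0//.
  apply/seteqP; split => p //= -[_ cp]; have := cos_le1 p; lra.
- rewrite setIidl; last by move=> p _ /=; have := cos_geN1 p; lra.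
  rewrite lebesgue_measure_itv/= lte_fin mulr_gt0 ?pi_gt0//= sube0 -EFinM mulVf//.
  by rewrite gt_eqF// mulr_gt0// pi_gt0.
- rewrite -leNgt => cN1; rewrite cos_superlevel ?cN1// -EFinM; congr EFin.
  have : 0 < pi :> R by exact: pi_gt0.
  by move: (acos c) pi => x q q0; field; rewrite gt_eqF.
Qed.

Lemma measurable_dist3_le (r1 r2 t2 p2 l : R) : 0 <= l ->
  measurable [set z : R * R | dist3 r1 z.1 z.2 r2 t2 p2 <= l].
Proof.
move=> l0; under eq_set do rewrite dist3_le//.
rewrite -[X in measurable X]setTI; apply: measurable_fun_le => //.
have m1 : measurable_fun setT (fun z : R * R => z.1) by exact: measurable_fst.
have m2 : measurable_fun setT (fun z : R * R => z.2) by exact: measurable_snd.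
apply: measurable_funB => //; apply: measurable_funM => //.
apply: measurable_funD; apply: measurable_funM => //.
- by apply: measurable_funM => //; exact: (measurableT_comp measurable_sin).
- by apply: (measurableT_comp measurable_cos); apply: measurable_funB.
- exact: (measurableT_comp measurable_cos).
Qed.

(** * The availability event and its cut at the maximal angle *)

(* The dummy satellite at the south pole is beaten by all others except those at
   [t = pi], where the density [sin t] vanishes. *)
Lemma iid_prob_avail N (RL RG Th thmax l : R) :
  let E := [set x : sph R | angle_to_IoT x <= thmax /\
                          dist3 RL x.1 x.2 RG Th 0 <= l] in
  iid_prob N.+1 (avail_event RL RG Th thmax l) =
  iid_prob N.+1 (fun s => E (relay (pi, 0) s)).
Proof.
move=> E; rewrite /= /unif_sphere_int.
apply: eq_integral => t; rewrite mem_setE in_itv/= => tpi.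
apply: eq_integral => p _.
have pipi : 0 <= (pi : R) <= pi by rewrite pi_ge0 lexx.
rewrite !angle_to_IoTE//.
have [//|pit] := ltP t pi.
have -> : t = pi by lra.
by rewrite sinpi mul0r !mule0.
Qed.

End Geometry.

Theorem theorem1 (R : realType) (RE RL RG Th lILmax lGmax : R) (N : nat) :
  0 < RE -> RE < RL -> RL < RG ->
  (1 <= N)%N ->
  0 < Th -> Th < pi ->
  RL - RE <= lILmax -> lILmax <= Num.sqrt (RL ^+ 2 - RE ^+ 2) ->
  0 < lGmax ->
  (* P^A = int_0^{theta_IL^max} f(theta) P_LG^A(theta) dtheta *)
  iid_prob N (avail_event RL RG Th (theta_IL_max RE RL lILmax) lGmax)
    = (\int[@lebesgue_measure R]_(t in `[0%R, theta_IL_max RE RL lILmax]%classic)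
         (f_theta_IL N t * P_LG_A RL RG Th lGmax t)%:E)%E
  /\
  (* P_LG^A(theta) is the probability, over the (conditionally uniform)
     azimuth of the relay, that its distance to the GEO satellite is <= lGmax *)
  (forall t : R, (0 < t)%R -> (t < pi)%R ->
     (P_LG_A RL RG Th lGmax t)%:E
       = ((2 * pi)^-1)%:E
         * @lebesgue_measure R (`[0%R, (2 * pi : R)%R]%classic
                             `&` [set p | (dist3 RL t p RG Th 0 <= lGmax)%R]))%E.
Proof.
move=> RE0 RERL RLRG N1 Th0 Thpi lIL1 lIL2 lG0.
have RL0 : 0 < RL by lra.
have RG0 : 0 < RG by lra.
have azimE t : 0 < t -> t < pi -> (P_LG_A RL RG Th lGmax t)%:E =
    azim [set z | dist3 RL z.1 z.2 RG Th 0 <= lGmax] t.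
  by move=> t0 tpi; apply: P_LG_A_azim => //; apply/andP.
split; last by move=> t t0 tpi; exact: azimE.
have /andP[th0 thpi] : 0 <= theta_IL_max RE RL lILmax <= pi.
  have l2 : lILmax ^+ 2 <= RL ^+ 2 - RE ^+ 2.
    have l0 : 0 <= lILmax by lra.
    rewrite -(@sqr_sqrtr _ (RL ^+ 2 - RE ^+ 2)); last by nra.
    by rewrite lerXn2r ?nnegrE// sqrtr_ge0.
  (* The upper bound amounts to [(RL - RE) ^+ 2 <= lILmax ^+ 2]; for the lower one, [l2] keeps the
     numerator at least [2 * RE ^+ 2]. *)
  have c11 : -1 <= (RL ^+ 2 + RE ^+ 2 - lILmax ^+ 2) / (2 * RL * RE) <= 1.
    have D0 : 0 < 2 * RL * RE by rewrite !mulr_gt0.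
    by rewrite ler_pdivlMr// ler_pdivrMr//; nra.
  by rewrite acos_ge0 ?acos_lepi.
move: (theta_IL_max _ _ _) th0 thpi => th th0 thpi.
case: N N1 => [//|N] _.
pose A : set (R * R) := [set z | z.1 <= th] `&`
  [set z | dist3 RL z.1 z.2 RG Th 0 <= lGmax].
have mA : measurable A.
  apply: measurableI; last by apply: measurable_dist3_le; exact: ltW.
  by rewrite -[X in measurable X]setTI; apply: measurable_fun_le.
rewrite iid_prob_avail (@iid_prob_relay _ A)//; last 2 first.
- by move=> t p tpi; rewrite /A/= angle_to_IoTE.
- by rewrite pi_ge0 lexx.
(* The dummy's own term carries a positive power of [cap pi = 0]. What remains is an integral over
   [[0, pi]], cut to [[0, th]] because [A] has empty sections beyond [th]. *)
rewrite cap_pi expr0n mul0r add0e /relay_avail !integral_itv_if.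
apply: eq_integral => t _; rewrite !in_itv/=.
have [tth|tth] := leP t th; last first.
  rewrite andbF; case: ifPn => // _.
  rewrite /azim (_ : _ `&` _ = set0) ?measure0 ?mule0//.
  by apply/seteqP; split => p //= -[_ [/=]]; lra.
rewrite (le_trans tth thpi) andbT; case: ifPn => // t0.
(* At [0] and [pi] the closed form divides by [sin t = 0], but the density vanishes there. *)
have [->|tN0] := eqVneq t 0.
  by rewrite /f_theta_IL sin0 mulr0 !mul0r mul0e.
have [->|tNpi] := eqVneq t pi.
  by rewrite /f_theta_IL sinpi mulr0 !mul0r mul0e.
rewrite [RHS]EFinM azimE; last 2 first.
- by rewrite lt_neqAle eq_sym tN0.
- by rewrite lt_neqAle tNpi (le_trans tth).
congr (_ * (_ * lebesgue_measure _))%E.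
by apply/seteqP; split => p /= [? ap]; split => //; case: ap.
Qed.
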